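(* Let $n\ge 1$ and let $\Omega\subseteq\mathbb{R}^n$ be a nonempty, open, bounded set. Then there exists a constant $c>0$, depending only on $n$ and $\Omega$, such that for every smooth function $u:\Omega\to\mathbb{R}$ satisfying $\Delta u\ge 1$ on $\Omega$ and every $1\le p\le\infty$ with conjugate exponent $p'$, $$\|u\|_{L^p(\Omega)}\cdot|\{x\in\Omega:|u(x)|\ge c\}|^{1/p'}\ge c .$$ In particular $c$ depends neither on $p$ nor on $u$.
   Context: Here $|E|$ denotes Lebesgue measure of a set $E$, $\Delta=\sum_{i=1}^n\partial_{x_i}^2$ is the Laplacian on $\mathbb{R}^n$, and $p'$ is defined by $1/p+1/p'=1$ with the convention $1/\infty=0$. When $p=1$ (so $1/p'=0$) the factor $|\{x\in\Omega:|u(x)|\ge c\}|^{1/p'}$ is interpreted as $1$, so that the inequality is just a lower bound on the $L^1$ norm. The norm $\|u\|_{L^p(\Omega)}$ is allowed to be $+\infty$. *)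

(* Defs.v *)
From HB Require Import structures.
From mathcomp Require Import all_boot all_order all_algebra.
From mathcomp Require Import all_classical all_reals all_analysis.

Set Implicit Arguments.
Unset Strict Implicit.
Unset Printing Implicit Defensive.
Import Order.TTheory GRing.Theory Num.Theory.
Import numFieldNormedType.Exports.
Local Open Scope classical_set_scope.
Local Open Scope ring_scope.

Section tuple_measure.
Context {R : realType}.

Definition tuple_cons n (x : R * n.-tuple R) : n.+1.-tuple R :=
  [tuple of x.1 :: x.2].

Lemma measurable_tuple_cons n : measurable_fun setT (@tuple_cons n).
Proof.
by apply: measurable_cons; [exact: measurable_fst|exact: measurable_snd].
Qed.

Section step.
Variables (n : nat) (m : {sigma_finite_measure set (n.-tuple R) -> \bar R}).

Definition cons_measure : set (n.+1.-tuple R) -> \bar R :=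
  pushforward (@lebesgue_measure R \x m)%E (@tuple_cons n).

Let pre A : measurable A -> measurable (@tuple_cons n @^-1` A).
Proof.
by move=> mA; rewrite -[X in measurable X]setTI; exact: measurable_tuple_cons.
Qed.

Let cons0 : cons_measure set0 = 0%E.
Proof. by rewrite /cons_measure /pushforward preimage_set0 measure0. Qed.

Let cons_ge0 A : (0 <= cons_measure A)%E.
Proof. by rewrite /cons_measure /pushforward measure_ge0. Qed.

Let cons_sigma_additive : semi_sigma_additive cons_measure.
Proof.
move=> F mF tF mUF; rewrite /cons_measure /pushforward preimage_bigcup.
apply: measure_semi_sigma_additive.
- by move=> i; exact: pre.
- apply/trivIsetP => /= i j _ _ ij; rewrite -preimage_setI.
  by move/trivIsetP : tF => /(_ _ _ _ _ ij) ->//; rewrite preimage_set0.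
- by rewrite -preimage_bigcup; exact: pre.
Qed.

HB.instance Definition _ := isMeasure.Build _ _ _ cons_measure
  cons0 cons_ge0 cons_sigma_additive.

(* [product_measure1] is not inferred to be sigma-finite through its canonical
   instances, hence the direct proof. *)
Let cons_sigma_finite : sigma_finite setT cons_measure.
Proof.
have /sigma_finiteP[F [TF ndF Foo]] := sigma_finiteT (@lebesgue_measure R).
have /sigma_finiteP[G [TG ndG Goo]] := sigma_finiteT m.
have consE k : @tuple_cons n @^-1` [set t | F k (thead t) /\
    G k [tuple of behead t]] = F k `*` G k.
  apply/seteqP; split => -[x t] /=; rewrite theadE (_ : [tuple of _] = t)//;
  exact/val_inj.
exists (fun k => [set t | F k (thead t) /\ G k [tuple of behead t]]).
  apply/seteqP; split => // t _.
  have [i _ Fi] : (\bigcup_i F i) (thead t) by rewrite -TF.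
  have [j _ Gj] : (\bigcup_i G i) [tuple of behead t] by rewrite -TG.
  exists (maxn i j) => //; split.
    by move: Fi; exact/subsetPset/ndF/leq_maxl.
  by move: Gj; exact/subsetPset/ndG/leq_maxr.
move=> k; have [mF Fk] := Foo k; have [mG Gk] := Goo k; split.
  apply: measurableI; rewrite -[X in measurable X]setTI.
    exact: measurable_tnth.
  exact: measurable_behead.
rewrite /cons_measure /pushforward consE product_measure1E//.
by rewrite lte_mul_pinfty// ge0_fin_numE.
Qed.

HB.instance Definition _ := Measure_isSigmaFinite.Build _ _ _ cons_measure
  cons_sigma_finite.

End step.

(* n-fold product of the Lebesgue measure on the line. *)
Fixpoint lebesgue_tuple n : {sigma_finite_measure set (n.-tuple R) -> \bar R} :=
  match n with
  | 0 => \d_([tuple] : 0.-tuple R)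
  | n'.+1 => cons_measure (lebesgue_tuple n')
  end.

End tuple_measure.

(* 'rV[R]_n with its Borel sigma-algebra; as a type it is convertible to
   'rV[R]_n, so that sets and functions need no transport. *)
Notation borel_rV R n := (g_sigma_algebraType (@open 'rV[R%type]_n)).

Section rV_measure.
Context {R : realType}.

Definition row_of_tuple n (t : n.-tuple R) : borel_rV R n := \row_i tnth t i.

Let rat_box n (q : 'rV[rat]_n * 'rV[rat]_n) : set 'rV[R]_n :=
  [set x | forall i, ratr (q.1 0 i) < x 0 i < ratr (q.2 0 i)].

Let open_rat_box n (U : set 'rV[R]_n) : open U ->
  U = \bigcup_(q in [set q | rat_box q `<=` U]) rat_box q.
Proof.
move=> oU; apply/seteqP; split => [x Ux|x [q qU]]; last exact: qU.
have /nbhs_ballP[e /= e0 xeU] : nbhs x U by exact: open_nbhs_nbhs.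
have lo i : {q : rat | x 0 i - e < ratr q < x 0 i}.
  apply: cid; have [|q] := @rat_in_itvoo R (x 0 i - e) (x 0 i).
    by rewrite ltrBlDr ltrDl.
  by rewrite in_itv /= => ?; exists q.
have hi i : {q : rat | x 0 i < ratr q < x 0 i + e}.
  apply: cid; have [|q] := @rat_in_itvoo R (x 0 i) (x 0 i + e).
    by rewrite ltrDl.
  by rewrite in_itv /= => ?; exists q.
exists (\row_i sval (lo i), \row_i sval (hi i)) => /=.
  move=> y xy; apply: xeU; split => // i j; rewrite (ord1 i).
  have /andP[] := xy j; rewrite /= !mxE.
  case: (lo j) (hi j) => [a /= /andP[a1 a2]] [b /= /andP[b1 b2]] ay yb.
  rewrite /ball /= ltr_norml; apply/andP; split.
    by rewrite ltrBrDl -ltrBrDr opprK (lt_trans yb).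
  by rewrite ltrBlDr -ltrBlDl (lt_trans a1).
move=> i; rewrite /= !mxE.
by case: (lo i) (hi i) => [a /= /andP[_ ->]] [b /= /andP[->]].
Qed.

Lemma measurable_row_of_tuple n : measurable_fun setT (@row_of_tuple n).
Proof.
apply: (@measurability _ _ _ (borel_rV R n) setT (@row_of_tuple n) (@open 'rV[R]_n)) => // _ [U oU <-].
rewrite setTI (open_rat_box oU) preimage_bigcup bigcup_mkcond.
apply: countable_bigcupT_measurable => [|q]; first exact: countableP.
case: ifP => // _.
rewrite (_ : _ @^-1` _ = \big[setI/setT]_(i < n)
    ((fun t : n.-tuple R => tnth t i) @^-1`
      `]ratr (q.1 0 i), ratr (q.2 0 i)[%classic)).
  apply: bigsetI_measurable => i _.
  by rewrite -[X in measurable X]setTI; exact: measurable_tnth.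
rewrite -bigcap_seq; apply/seteqP; split => t /= ht i.
  by move=> _; have := ht i; rewrite /= mxE in_itv.
by have := ht i (mem_index_enum _); rewrite /= in_itv /= mxE.
Qed.

(* Lebesgue measure on R^n, on the Borel sets; see [lebesgue_rV_box]. *)
Definition lebesgue_rV n : set (borel_rV R n) -> \bar R :=
  pushforward (@lebesgue_tuple R n) (@row_of_tuple n).

Section instance.
Variable n : nat.

Let pre (A : set (borel_rV R n)) : measurable A ->
  measurable (@row_of_tuple n @^-1` A).
Proof.
by move=> mA; rewrite -[X in measurable X]setTI; exact: measurable_row_of_tuple.
Qed.

Let rV0 : lebesgue_rV (@set0 (borel_rV R n)) = 0%E.
Proof. by rewrite /lebesgue_rV /pushforward preimage_set0 measure0. Qed.

Let rV_ge0 A : (0 <= @lebesgue_rV n A)%E.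
Proof. by rewrite /lebesgue_rV /pushforward measure_ge0. Qed.

Let rV_sigma_additive : semi_sigma_additive (@lebesgue_rV n).
Proof.
move=> F mF tF mUF; rewrite /lebesgue_rV /pushforward preimage_bigcup.
apply: measure_semi_sigma_additive.
- by move=> i; exact: pre.
- apply/trivIsetP => /= i j _ _ ij; rewrite -preimage_setI.
  by move/trivIsetP : tF => /(_ _ _ _ _ ij) ->//; rewrite preimage_set0.
- by rewrite -preimage_bigcup; exact: pre.
Qed.

HB.instance Definition _ := isMeasure.Build _ _ _ (@lebesgue_rV n)
  rV0 rV_ge0 rV_sigma_additive.

End instance.

Lemma lebesgue_tuple_box n (A : 'I_n -> set R) : (forall i, measurable (A i)) ->
  @lebesgue_tuple R n [set t | forall i, A i (tnth t i)] =
  (\prod_(i < n) lebesgue_measure (A i))%E.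
Proof.
elim: n A => [A _|n ih A mA].
  rewrite big_ord0 /= diracE mem_set// => -[]//.
have mtail : measurable
    [set t : n.-tuple R | forall i, A (lift ord0 i) (tnth t i)].
  rewrite (_ : mkset _ = \big[setI/setT]_(i < n)
      ((fun t : n.-tuple R => tnth t i) @^-1` A (lift ord0 i))).
    apply: bigsetI_measurable => i _.
    by rewrite -[X in measurable X]setTI; exact: measurable_tnth.
  rewrite -bigcap_seq; apply/seteqP; split => t /= ht i.
    by move=> _; exact: ht.
  by apply: ht; exact: mem_index_enum.
rewrite big_ord_recl /= /cons_measure /pushforward.
rewrite (_ : _ @^-1` _ =
    A ord0 `*` [set t | forall i, A (lift ord0 i) (tnth t i)]).
  rewrite product_measure1E; [|exact: mA|exact: mtail].
  by congr (_ * _)%E; exact: (ih (fun i => A (lift ord0 i)) (fun i => mA _)).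
apply/seteqP; split => -[x t] /=.
  move=> h; split => [|i]; first exact: (h ord0).
  by have := h (lift ord0 i); rewrite tnthS.
move=> [h0 h] i; case: (unliftP ord0 i) => [j|] ->; last by [].
by rewrite tnthS.
Qed.

Lemma lebesgue_rV_box n (A : 'I_n -> set R) : (forall i, measurable (A i)) ->
  @lebesgue_rV n [set x : 'rV[R]_n | forall i, A i (x 0 i)] =
  (\prod_(i < n) lebesgue_measure (A i))%E.
Proof.
move=> mA; rewrite -lebesgue_tuple_box// /lebesgue_rV /pushforward.
congr (lebesgue_tuple _ _); apply/seteqP.
by split => t /= h i; have := h i; rewrite mxE.
Qed.

End rV_measure.
Arguments lebesgue_rV R n _ : clear implicits.

Section calculus.
Context {R : realType}.
Variable n : nat.
Implicit Types (D : set 'rV[R]_n) (u : 'rV[R]_n -> R).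

Definition partial (i : 'I_n) u : 'rV[R]_n -> R :=
  fun x => 'D_(delta_mx 0 i) u x.

(* [derive] is total: [partial i u] is meaningful only where the derivative
   exists, which [Ck_on] requires at every point of D. For D open, [Ck_on k D u]
   depends only on the restriction of u to D. *)
Fixpoint Ck_on (k : nat) D u : Prop :=
  (forall x, D x -> {for x, continuous u}) /\
  match k with
  | 0 => True
  | k'.+1 => forall i : 'I_n,
      (forall x, D x -> derivable u x (delta_mx 0 i)) /\ Ck_on k' D (partial i u)
  end.

Definition smooth_on D u : Prop := forall k, Ck_on k D u.

Definition laplacian u : 'rV[R]_n -> R :=
  fun x => \sum_(i < n) partial i (partial i u) x.

End calculus.

(* Main.v *)
Require Import Defs.
From mathcomp Require Import all_boot all_order all_algebra.
From mathcomp Require Import all_classical all_reals all_analysis.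
From mathcomp Require Import measurable_realfun ess_sup_inf ring lra.
Import Order.TTheory GRing.Theory Num.Theory.
Import numFieldNormedType.Exports.
Local Open Scope classical_set_scope.
Local Open Scope ring_scope.

(** The condition [Lap u >= 1] is tested against a fixed bump. Let [Q] be a
closed cube of half-side [r] contained in [Omega], and let [phi >= 0] be a
function that vanishes to second order on the faces of [Q]. Integrating by
parts twice,
  int_Q phi <= int_Q phi * Lap u = int_Q u * Lap phi <= M * int_Q |u|,
where [M] bounds [Lap phi] on [Q]; so the mass of [|u|] on [Q] is at least
[a / M], with [a] a lower bound for the integral of [phi], and this number only
depends on [Q] ([integral_cube_ge]). The part of [Q] where [|u| < c] carries
mass at most [c |Q|]. For [c = a / (M (|Q| + 1))] this leaves mass at least [c]
on [E = {|u| >= c}], and Hoelder's inequality for [|u|] and the indicator of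
[E] bounds that mass by [||u||_p * |E|^(1/p')] ([integral_le_Lnorm_measure]).

The bump is the product over the coordinates of the quartics
[(r^2 - (t - c_j)^2)^2]. With this choice Green's identity in direction [i]
becomes, on each line parallel to the [i]-th axis, an instance of the
one-dimensional identity [integral_second_green], in which the boundary terms
vanish because the quartic and its derivative do. The lines are
put together by [integral_rV_slice0], the consequence of Fubini's theorem that
an integrable function whose integrals along all lines of one direction vanish
has integral zero. *)

Set Implicit Arguments.
Unset Strict Implicit.
Unset Printing Implicit Defensive.

(** * Hoelder's inequality against an indicator *)

Section hoelder_on_set.
Context d (T : measurableType d) (R : realType).
Variable mu : {measure set T -> \bar R}.
Local Open Scope ereal_scope.

(** The exponents [1] and [+oo] are treated apart: Hoelder's inequality for
[Lnorm] asks for two finite exponents. For [p = +oo] the case [mu E = 0] has to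
be separated as well, since the essential supremum may then be infinite while
its product with [mu E] is zero. *)
Lemma integral_le_Lnorm_measure (f : T -> R) (E : set T) (p : \bar R) :
  measurable_fun [set: T] f -> measurable E -> 1 <= p ->
  \int[mu]_(x in E) `|f x|%:E <=
    Lnorm mu p (EFin \o f) * mu E `^ fine (hoelder_conjugate p)^-1.
Proof.
move=> mf mE; case: p => [p| |//]; last first.
  move=> _; rewrite hoelder_conjugatey inve1 /= poweRe1//.
  have [muE|/eqP muE] := eqVneq (mu E) 0.
    rewrite muE mule0 (@null_set_integral _ _ _ mu E)//.
    by apply/measurable_EFinP; apply: measurable_funTS; apply: measurableT_comp.
  have muT : 0 < mu [set: T].
    rewrite (@lt_le_trans _ _ (mu E))//.
      by rewrite lt0e measure_ge0 andbT; apply/eqP.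
    by apply: le_measure => //; rewrite inE.
  rewrite unlock muT -integral_cst//.
  apply: ae_ge0_le_integral => //.
  - by apply/measurable_EFinP; apply: measurable_funTS; apply: measurableT_comp.
  - by move=> x _; apply: ess_sup_gee => //; apply: nearW => y /=.
  - apply: filterS (ess_sup_ge mu (abse \o (EFin \o f))) => x /= h _.
    exact: h.
rewrite lee_fin => p1.
have E1 : \int[mu]_(x in E) `|f x|%:E = Lnorm mu 1 (EFin \o (f \* \1_E)%R).
  rewrite Lnorm1 integral_mkcond; apply: eq_integral => x _ /=.
  rewrite patchE indicE; case: ifPn => xE /=; first by rewrite mulr1.
  by rewrite mulr0 normr0.
have [->|pN1] := eqVneq p 1%R.
  rewrite hoelder_conjugate1 invey /= poweRe0 mule1 E1 !Lnorm1.
  apply: ge0_le_integral => //.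
  - by apply/measurableT_comp => //; apply/measurable_EFinP/measurable_funM.
  - by apply/measurableT_comp => //; apply/measurable_EFinP.
  - move=> x _ /=; rewrite lee_fin normrM ler_piMr// indicE.
    by case: (x \in E); rewrite ?normr1 ?normr0.
have {p1 pN1}p1 : (1 < p)%R by rewrite lt_neqAle eq_sym pN1.
have p0 : (0 < p)%R by apply: lt_trans p1.
have pm1 : (0 < p - 1)%R by rewrite subr_gt0.
pose q : R := (p / (p - 1))%R.
have q0 : (0 < q)%R by rewrite divr_gt0.
have -> : hoelder_conjugate p%:E = q%:E.
  rewrite /hoelder_conjugate/= eqe gt_eqF// -EFinB inver gt_eqF//.
rewrite inver gt_eqF//= E1.
have -> : mu E `^ q^-1 = Lnorm mu q%:E (EFin \o \1_E).
  rewrite unlock; congr (_ `^ _); rewrite -(setIT E) -integral_indic//.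
  apply: eq_integral => x _ /=; rewrite setIT indicE.
  by case: (x \in E); rewrite ?normr1 ?normr0 ?powR1 ?powR0 ?gt_eqF.
apply: hoelder => //.
rewrite /q invf_div -[X in (X + _)%R]mul1r -mulrDl addrCA subrr addr0.
by rewrite divff// gt_eqF.
Qed.

End hoelder_on_set.

(** * Integration along parallel lines *)

Section pushforward.
Context d1 d2 (X : measurableType d1) (Y : measurableType d2) (R : realType).
Variables (phi : X -> Y) (mu : {measure set X -> \bar R}).
Hypothesis mphi : measurable_fun setT phi.
Local Open Scope ereal_scope.

(** The measure [nu] is only assumed equal to the pushforward as a set function,
because [cons_measure] and [lebesgue_rV] carry measure structures of their
own. *)
Lemma integrable_integral_pushforward (nu : {measure set Y -> \bar R})
    (f : Y -> \bar R) :
  nu = pushforward mu phi :> (set Y -> \bar R) ->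
  nu.-integrable setT f -> mu.-integrable setT (f \o phi) /\
    \int[nu]_y f y = \int[mu]_x f (phi x).
Proof.
move=> nuE intf; have mf := measurable_int _ intf.
have intg : mu.-integrable setT (f \o phi).
  apply/integrableP; split; first exact (measurableT_comp mf mphi).
  move/integrableP : intf => [_]; apply: le_lt_trans.
  rewrite nuE (ge0_integral_pushforward mphi)//; exact: measurableT_comp.
split => //.
by rewrite nuE (integral_pushforward mphi mf intg measurableT) preimage_setT.
Qed.

End pushforward.

Section slices.
Context {R : realType}.

Definition set_tnth n (i : 'I_n) (s : R) (t : n.-tuple R) : n.-tuple R :=
  [tuple if j == i then s else tnth t j | j < n].

Local Open Scope ereal_scope.

(** Induction on the dimension. If [i] is the first coordinate, integrate in it
first: the inner integral vanishes identically. Otherwise leave the first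
coordinate for last: by induction the inner integral vanishes for each of its
values for which the slice is integrable, that is, almost everywhere. *)
Lemma integral_tuple_slice0 n (i : 'I_n) (f : n.-tuple R -> R) :
  (lebesgue_tuple n).-integrable setT (EFin \o f) ->
  (forall t, \int[lebesgue_measure]_s (f (set_tnth i s t))%:E = 0) ->
  \int[lebesgue_tuple n]_t (f t)%:E = 0.
Proof.
elim: n i f => [[]//|n ih] i f intf f0.
(* [measurableTypeR R] is [R] with the sigma-algebra on which
   [lebesgue_measure] is defined. *)
have mc : measurable_fun [set: measurableTypeR R * n.-tuple R]
  (@tuple_cons R n) by exact: measurable_tuple_cons.
have [intg ->] := integrable_integral_pushforward
  (mu := (@lebesgue_measure R \x lebesgue_tuple n)%E) mc erefl intf.
case: (unliftP ord0 i) => [j|] ie; subst i.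
- rewrite -integral12_prod_meas1//.
  rewrite (ae_eq_integral (cst 0)) => [|//||//|]; first by rewrite integral0.
    exact: (measurable_fubini_F intg).
  apply: filterS (ae_integrable1 intg) => s ints _ /=.
  apply: (ih j (fun t => f (tuple_cons (s, t)))) => // t.
  rewrite -[RHS](f0 (tuple_cons (s, t))); apply: eq_integral => s' _.
  congr (EFin (f _)); apply/eq_from_tnth => k.
  rewrite tnth_mktuple; case: (unliftP ord0 k) => [k'|] ->.
    by rewrite !tnthS tnth_mktuple (inj_eq lift_inj).
  by rewrite (negbTE (neq_lift _ _))//; rewrite !tnth0.
- rewrite -integral21_prod_meas1//.
  rewrite -[RHS](integral0 (lebesgue_tuple n) setT); apply: eq_integral => t _.
  rewrite -[RHS](f0 (tuple_cons (0%R, t))); apply: eq_integral => s _.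
  congr (EFin (f _)); apply/eq_from_tnth => k.
  rewrite tnth_mktuple; case: (unliftP ord0 k) => [k'|] ->.
    by rewrite eq_sym (negbTE (neq_lift _ _)) !tnthS.
  by rewrite eqxx tnth0.
Qed.

Definition set_coord n (i : 'I_n) (s : R) (x : 'rV[R]_n) : 'rV[R]_n :=
  \row_j if j == i then s else x 0%R j.

Lemma integral_rV_slice0 n (i : 'I_n) (f : 'rV[R]_n -> R) :
  (lebesgue_rV R n).-integrable setT (EFin \o f) ->
  (forall x, \int[lebesgue_measure]_s (f (set_coord i s x))%:E = 0) ->
  \int[lebesgue_rV R n]_x (f x)%:E = 0.
Proof.
move=> intf f0.
have [intg ->] := @integrable_integral_pushforward _ _ _ (borel_rV R n) R _
  (lebesgue_tuple n) (@measurable_row_of_tuple R n) (lebesgue_rV R n) _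
  erefl intf.
apply: (@integral_tuple_slice0 n i (f \o @row_of_tuple R n) intg) => t /=.
rewrite -[RHS](f0 (row_of_tuple t)); apply: eq_integral => s _.
congr (EFin (f _)); apply/rowP => j.
by rewrite !mxE tnth_mktuple.
Qed.

End slices.

(** * Green's second identity on an interval *)

Section one_dimension.
Context {R : realType}.

(** The integrand is the derivative of [b v' - v b'], which vanishes at both
endpoints. *)
Lemma integral_second_green (v v1 v2 b b1 b2 : R -> R) (l r : R) : l < r ->
  (forall t, t \in `[l, r] -> is_derive t 1 v (v1 t)) ->
  (forall t, t \in `[l, r] -> is_derive t 1 v1 (v2 t)) ->
  (forall t, t \in `[l, r] -> is_derive t 1 b (b1 t)) ->
  (forall t, t \in `[l, r] -> is_derive t 1 b1 (b2 t)) ->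
  (forall t, t \in `[l, r] -> {for t, continuous v2}) ->
  (forall t, t \in `[l, r] -> {for t, continuous b2}) ->
  b l = 0 -> b1 l = 0 -> b r = 0 -> b1 r = 0 ->
  (\int[lebesgue_measure]_(t in `[l, r]) (b t * v2 t - v t * b2 t)%:E = 0)%E.
Proof.
move=> lr dv dv1 db db1 cv2 cb2 bl b1l br b1r.
have cont (g g' : R -> R) (t : R) :
    is_derive t 1 g (g' t) -> {for t, continuous (g : R -> R)}.
  by move=> [dg _]; apply: differentiable_continuous; apply/derivable1_diffP.
pose W t := b t * v1 t - v t * b1 t.
have dW t : t \in `[l, r] -> is_derive t 1 W (b t * v2 t - v t * b2 t).
  move=> ht; have ? := dv t ht; have ? := dv1 t ht.
  have ? := db t ht; have ? := db1 t ht.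
  have -> : W = b * v1 - v * b1 by apply/funext.
  apply: is_derive_eq; rewrite /GRing.scale /=; ring.
have cW t : t \in `[l, r] -> {for t, continuous W}.
  by move=> ht; apply: (cont _ (fun t => b t * v2 t - v t * b2 t)); exact: dW.
have sub t : t \in `]l, r[ -> t \in `[l, r] by apply: subset_itv_oo_cc.
rewrite (@continuous_FTC2 _ _ W)//.
- by rewrite /W bl b1l br b1r !mul0r !mulr0 subrr subee.
- apply: continuous_in_subspaceT => t; rewrite inE /= => ht.
  have cv := cont _ _ _ (dv t ht).
  have cb := cont _ _ _ (db t ht).
  by apply: cvgB; apply: cvgM; [exact: cb|exact: cv2|exact: cv|exact: cb2].
- split.
  + by move=> t /sub /dW [].
  + by apply: cvg_at_right_filter; apply: cW; rewrite in_itv /= lexx ltW.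
  + by apply: cvg_at_left_filter; apply: cW; rewrite in_itv /= lexx ltW.
- by move=> t /sub /dW [_ <-]; rewrite derive1E.
Qed.

(** The quartic with double zeros at [c - r] and [c + r], followed by its first
and second derivatives. *)
Definition bell (c r t : R) := (r ^+ 2 - (t - c) ^+ 2) ^+ 2.
Definition dbell (c r t : R) := - 4 * (t - c) * (r ^+ 2 - (t - c) ^+ 2).
Definition ddbell (c r t : R) := 12 * (t - c) ^+ 2 - 4 * r ^+ 2.

Lemma is_derive_bell (c r t : R) : is_derive t 1 (bell c r) (dbell c r t).
Proof.
rewrite (_ : bell c r = (cst (r ^+ 2) - (id - cst c) ^+ 2) ^+ 2); last first.
  by apply/funext => s.
apply: is_derive_eq; rewrite /GRing.scale /dbell /=.
rewrite -[(cst _ - _) t]/(r ^+ 2 - (t - c) ^+ 2) -[(id - cst c) t]/(t - c).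
ring.
Qed.

Lemma is_derive_dbell (c r t : R) : is_derive t 1 (dbell c r) (ddbell c r t).
Proof.
rewrite (_ : dbell c r =
    (- 4) *: (id - cst c) * (cst (r ^+ 2) - (id - cst c) ^+ 2)); last first.
  by apply/funext => s.
apply: is_derive_eq; rewrite /GRing.scale /ddbell /=.
rewrite -[(cst _ - _) t]/(r ^+ 2 - (t - c) ^+ 2) -[(id - cst c) t]/(t - c).
rewrite -[_ *: (t - c)]/(- 4 * (t - c)); ring.
Qed.

Lemma continuous_bell (c r : R) : continuous (bell c r).
Proof.
move=> t; apply: differentiable_continuous; apply/derivable1_diffP.
by have [] := is_derive_bell c r t.
Qed.

Lemma continuous_ddbell (c r : R) : continuous (ddbell c r).
Proof.
move=> t; apply: differentiable_continuous; apply/derivable1_diffP.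
rewrite (_ : ddbell c r = 12 *: (id - cst c) ^+ 2 - cst (4 * r ^+ 2)).
  by [].
by apply/funext => s.
Qed.

End one_dimension.

(** * Functions restricted to a line parallel to an axis *)

Section lines.
Context {R : realType}.
Variable n : nat.
Implicit Types (i : 'I_n) (x : 'rV[R]_n).

Lemma set_coordD i s t x :
  set_coord i (s + t) x = s *: delta_mx 0 i + set_coord i t x.
Proof.
apply/rowP => j; rewrite !mxE eqxx /= [j == i]eq_sym eq_sym.
by case: eqP => _; rewrite ?mulr1 // mulr0 add0r.
Qed.

Lemma continuous_set_coord i x : continuous (fun s => set_coord i s x).
Proof.
move=> t; under eq_fun do rewrite -[X in set_coord i X]addr0 set_coordD.
apply: cvgD; last exact: cvg_cst.
by rewrite -[X in _ --> X]/(t *: _); apply: cvgZr_tmp; exact: cvg_id.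
Qed.

Lemma is_derive_set_coord (u : 'rV[R]_n -> R) i t x :
  derivable u (set_coord i t x) (delta_mx 0 i) ->
  is_derive t 1 (fun s => u (set_coord i s x)) (partial i u (set_coord i t x)).
Proof.
have E : (fun h : R => h^-1 *: ((fun s => u (set_coord i s x)) (h *: 1 + t) -
      u (set_coord i t x))) =
    (fun h => h^-1 *: (u (h *: delta_mx 0 i + set_coord i t x) -
      u (set_coord i t x))).
  by apply/funext => h; rewrite -set_coordD /GRing.scale /= mulr1.
by move=> du; split; rewrite /derivable /derive /partial E.
Qed.

End lines.

(** * Cubes *)

Section cube.
Context {R : realType} (n : nat).
Implicit Types (Omega : set 'rV[R]_n) (x c : 'rV[R]_n) (r : R) (i : 'I_n).

Definition cube c r : set 'rV[R]_n :=
  [set x | forall i, x 0 i \in `[c 0 i - r, c 0 i + r]].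

Lemma open_cube Omega c : open Omega -> Omega c ->
  exists2 r, 0 < r & cube c r `<=` Omega.
Proof.
move=> oO Oc; have /nbhs_ballP[e /= e0 ceO] : nbhs c Omega.
  exact: open_nbhs_nbhs.
exists (e / 2) => [|x cx]; first by rewrite divr_gt0.
apply: ceO; split => // k i; rewrite (ord1 k).
have := cx i; rewrite in_itv /= => /andP[h1 h2].
rewrite /ball /= ltr_norml; apply/andP; split; lra.
Qed.

Lemma compact_cube c r : compact (cube c r).
Proof.
apply: (@rV_compact R n (fun i => `[c 0 i - r, c 0 i + r]%classic)) => i.
exact: segment_compact.
Qed.

Lemma measurable_open_rV (U : set (borel_rV R n)) :
  open (U : set 'rV[R]_n) -> measurable U.
Proof. by move=> oU; exact: sub_sigma_algebra. Qed.

Lemma measurable_cube c r : measurable (cube c r : set (borel_rV R n)).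
Proof.
have clQ : closed (cube c r).
  exact: compact_closed (@norm_hausdorff R _) (@compact_cube c r).
rewrite -[X in measurable X]setCK; apply: measurableC.
by apply: measurable_open_rV; exact: closed_openC.
Qed.

Lemma lebesgue_cube c r : 0 <= r ->
  lebesgue_rV R n (cube c r) = ((r *+ 2) ^+ n)%:E.
Proof.
move=> r0; rewrite [LHS](lebesgue_rV_box
  (A := fun i => `[c 0 i - r, c 0 i + r]%classic))//.
rewrite (eq_bigr (fun=> (r *+ 2)%:E)) => [|i _].
  rewrite prodEFin; congr EFin.
  by rewrite prodr_const card_ord.
rewrite lebesgue_measure_itv /= lte_fin.
case: ltP => h; last by congr EFin; lra.
by rewrite -EFinB; congr EFin; lra.
Qed.

Lemma measurable_continuous_rV Omega (f : 'rV[R]_n -> R) : open Omega ->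
  (forall x, Omega x -> {for x, continuous f}) ->
  measurable_fun (Omega : set (borel_rV R n)) (f : borel_rV R n -> R).
Proof.
move=> oO cf; apply: (measurability _ (RGenOpens.measurableE R)).
move=> _ [_ [a [b ->] <-]]; apply: measurable_open_rV.
rewrite openE => x [Ox fx]; apply: filterI; first exact: open_nbhs_nbhs.
by apply: (cf x Ox); apply: open_nbhs_nbhs; split => //; exact: interval_open.
Qed.

Lemma integrable_cube Omega c r (f : 'rV[R]_n -> R) : open Omega ->
  (forall x, Omega x -> {for x, continuous f}) -> 0 <= r ->
  cube c r `<=` Omega ->
  (lebesgue_rV R n).-integrable (cube c r) (EFin \o f).
Proof.
move=> oO cf r0 QO.
apply: (@measurable_bounded_integrable _ (borel_rV R n)).
- exact: measurable_cube.
- rewrite -[X in (X < _)%E]/(lebesgue_rV R n (cube c r)).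
  by rewrite lebesgue_cube// ltry.
- apply: (@measurable_funS _ _ (borel_rV R n) _ Omega) => //.
    exact: measurable_open_rV.
  exact: measurable_continuous_rV.
- have : compact (f @` cube c r).
    apply: continuous_compact; last exact: compact_cube.
    by apply: continuous_in_subspaceT => x; rewrite inE => /QO /cf.
  move=> /compact_bounded [M [Mr HM]]; exists M; split => // y My x Qx.
  by apply: HM My _ _; exists x.
Qed.

Lemma set_coord_cube i s x c r : cube c r (set_coord i s x) <->
  s \in `[c 0 i - r, c 0 i + r] /\
  forall j, j != i -> x 0 j \in `[c 0 j - r, c 0 j + r].
Proof.
split=> [h|[hs hx] j].
  split; first by have := h i; rewrite mxE eqxx.
  by move=> j ji; have := h j; rewrite mxE (negbTE ji).
by rewrite mxE; case: eqVneq => [->|/hx].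
Qed.

End cube.

(** * The bump on a cube *)

Section cube_bell.
Context {R : realType} (n : nat).
Implicit Types (Omega : set 'rV[R]_n) (x c : 'rV[R]_n) (r : R) (i : 'I_n).

Definition cube_bell c r x : R := \prod_(j < n) bell (c 0 j) r (x 0 j).

(** The second partial derivative of [cube_bell c r] in direction [i]. *)
Definition ddcube_bell c r i x : R :=
  \prod_(j < n) (if j == i then ddbell else bell) (c 0 j) r (x 0 j).

Lemma cube_bell_set_coord c r i s x : cube_bell c r (set_coord i s x) =
  (\prod_(j < n | j != i) bell (c 0 j) r (x 0 j)) * bell (c 0 i) r s.
Proof.
rewrite /cube_bell (bigD1 i)//= mxE eqxx mulrC; congr (_ * _).
by apply: eq_bigr => j ji; rewrite mxE (negbTE ji).
Qed.

Lemma ddcube_bell_set_coord c r i s x : ddcube_bell c r i (set_coord i s x) =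
  (\prod_(j < n | j != i) bell (c 0 j) r (x 0 j)) * ddbell (c 0 i) r s.
Proof.
rewrite /ddcube_bell (bigD1 i)//= mxE eqxx mulrC; congr (_ * _).
by apply: eq_bigr => j ji; rewrite mxE (negbTE ji).
Qed.

Lemma continuous_cube_bell c r : continuous (cube_bell c r).
Proof.
apply: continuous_big => [[a b]|j _ x]; first exact: mul_continuous.
apply: (continuous_comp (g := bell (c 0 j) r)); first exact: coord_continuous.
exact: continuous_bell.
Qed.

Lemma continuous_ddcube_bell c r i : continuous (ddcube_bell c r i).
Proof.
apply: continuous_big => [[a b]|j _ x]; first exact: mul_continuous.
case: ifP => _.
  apply: (continuous_comp (g := ddbell (c 0 j) r)).
    exact: coord_continuous.
  exact: continuous_ddbell.
apply: (continuous_comp (g := bell (c 0 j) r)); first exact: coord_continuous.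
exact: continuous_bell.
Qed.

Lemma cube_bell_ge0 c r x : 0 <= cube_bell c r x.
Proof. by apply: prodr_ge0 => j _; exact: sqr_ge0. Qed.

(** On the concentric cube of half the size each factor is at least
[(r^2 - r^2 / 4)^2], which exceeds [(r / 2)^4]. *)
Lemma cube_bell_ge c r x : 0 <= r -> cube c (r / 2) x ->
  ((r / 2) ^+ 4) ^+ n <= cube_bell c r x.
Proof.
move=> r0 Qx; rewrite -[X in _ ^+ X]card_ord -prodr_const.
apply: ler_prod => j _; rewrite exprn_ge0 ?divr_ge0//=.
have := Qx j; rewrite in_itv /= => /andP[h1 h2].
rewrite /bell (exprM _ 2 2) ler_sqr ?nnegrE; nra.
Qed.

(** The base is a common bound for the two kinds of factors: on the cube,
[bell] lies between [0] and [r^4], and [ddbell] between [- 16 r^2] and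
[16 r^2]. *)
Lemma norm_ddcube_bell_le c r i x : cube c r x ->
  `|ddcube_bell c r i x| <= (1 + r ^+ 4 + 16 * r ^+ 2) ^+ n.
Proof.
move=> Qx; rewrite normr_prod -[X in _ ^+ X]card_ord -prodr_const.
apply: ler_prod => j _; rewrite normr_ge0 /=.
have := Qx j; rewrite in_itv /= => /andP[h1 h2].
have h : (x 0 j - c 0 j) ^+ 2 <= r ^+ 2 by nra.
have h0 := sqr_ge0 (x 0 j - c 0 j).
have r4 : 0 <= r ^+ 4 by rewrite exprn_even_ge0.
case: ifP => _; rewrite ler_norml; apply/andP; split.
- by rewrite /ddbell; lra.
- by rewrite /ddbell; lra.
- by have := sqr_ge0 (r ^+ 2 - (x 0 j - c 0 j) ^+ 2); rewrite /bell; lra.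
- suff : bell (c 0 j) r (x 0 j) <= r ^+ 4 by lra.
  by rewrite /bell (exprM _ 2 2) ler_sqr ?nnegrE; lra.
Qed.

Definition green_integrand c r i (u : 'rV[R]_n -> R) x : R :=
  cube_bell c r x * partial i (partial i u) x - u x * ddcube_bell c r i x.

Lemma continuous_green_integrand Omega c r i (u : 'rV[R]_n -> R) x :
  Ck_on 2 Omega u -> Omega x -> {for x, continuous (green_integrand c r i u)}.
Proof.
move=> [cu /(_ i) [_ [_ /(_ i) [_ [cu2 _]]]]] Ox.
apply: (@continuousB _ _ _
  (fun y => cube_bell c r y * partial i (partial i u) y)
  (fun y => u y * ddcube_bell c r i y)); apply: continuousM.
- exact: continuous_cube_bell.
- exact: cu2.
- exact: cu.
- exact: continuous_ddcube_bell.
Qed.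

(** Along a line of direction [i] that meets the cube, the other factors of the
bump form a constant [P], and the one-dimensional identity applies to
[P * bell]; along the other lines the integrand restricted to the cube is
zero. *)
Lemma integral_cube_green_coord Omega c r i (u : 'rV[R]_n -> R) :
  open Omega -> 0 < r -> cube c r `<=` Omega -> Ck_on 2 Omega u ->
  (\int[lebesgue_rV R n]_(x in cube c r) (green_integrand c r i u x)%:E = 0)%E.
Proof.
move=> oO r0 QO Cu; pose f := green_integrand c r i u.
have cf x := @continuous_green_integrand Omega c r i u x Cu.
have intf := integrable_cube oO cf (ltW r0) QO.
move: Cu => [cu /(_ i) [du [_ /(_ i) [du1 [cu2 _]]]]].
rewrite integral_mkcond.
have restE : (fun x => (f x)%:E) \_ (cube c r) = EFin \o (f \_ (cube c r)).
  by rewrite restrict_EFin.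
rewrite restE; apply: (@integral_rV_slice0 _ _ i (f \_ (cube c r))).
  rewrite -restE.
  exact: (integrable_mkcond _ (measurable_cube c r)).1 intf.
move=> x.
have [xQ|xQ] := pselect (forall j, j != i ->
    x 0 j \in `[c 0 j - r, c 0 j + r]); last first.
  rewrite -[RHS](integral0 lebesgue_measure setT); apply: eq_integral => s _.
  by rewrite patchE memNset// => /set_coord_cube [].
pose P := \prod_(j < n | j != i) bell (c 0 j) r (x 0 j).
have lO s : s \in `[c 0 i - r, c 0 i + r] -> Omega (set_coord i s x).
  by move=> hs; apply: QO; apply/set_coord_cube.
transitivity (\int[lebesgue_measure]_(s in `[(c 0 i - r)%R, (c 0 i + r)%R])
   ((P * bell (c 0 i) r s) * partial i (partial i u) (set_coord i s x) -
    u (set_coord i s x) * (P * ddbell (c 0 i) r s))%:E)%E.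
  rewrite [RHS]integral_mkcond; apply: eq_integral => s _.
  rewrite !patchE; case: ifPn => hs.
    rewrite mem_set; last first.
      by move: hs; rewrite inE => /set_coord_cube [].
    by rewrite /f /green_integrand cube_bell_set_coord ddcube_bell_set_coord.
  rewrite memNset// => /= hs2; move/negP: hs; apply; rewrite inE.
  exact/set_coord_cube.
apply: (@integral_second_green R (fun s => u (set_coord i s x))
  (fun s => partial i u (set_coord i s x)) _
  (fun s => P * bell (c 0 i) r s) (fun s => P * dbell (c 0 i) r s)).
- lra.
- by move=> s /lO Os; apply: is_derive_set_coord; exact: du.
- by move=> s /lO Os; apply: is_derive_set_coord; exact: du1.
- move=> s _; have ? := is_derive_bell (c 0 i) r s.
  have -> : (fun s => P * bell (c 0 i) r s) = P *: bell (c 0 i) r.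
    exact/funext.
  exact: is_derive_eq.
- move=> s _; have ? := is_derive_dbell (c 0 i) r s.
  have -> : (fun s => P * dbell (c 0 i) r s) = P *: dbell (c 0 i) r.
    exact/funext.
  exact: is_derive_eq.
- move=> s /lO Os; apply: continuous_comp; first exact: continuous_set_coord.
  exact: cu2.
- by move=> s _; apply: cvgM; [exact: cvg_cst|exact: continuous_ddbell].
- by rewrite /bell; ring.
- by rewrite /dbell; ring.
- by rewrite /bell; ring.
- by rewrite /dbell; ring.
Qed.

End cube_bell.

(** * A lower bound for the mass on a cube *)

Section mass_on_cube.
Context {R : realType} (n : nat).
Local Open Scope ereal_scope.

(** Tests [Lap u >= 1] against the bump. The left-hand side bounds the integral
of the bump from below by means of the concentric cube of half-side [r / 2],
on which the bump is at least [((r / 2)^4)^n] and whose measure is [r^n]; the factor on the right-hand side is a bound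
for the Laplacian of the bump. *)
Lemma integral_cube_ge (Omega : set 'rV[R]_n) c r (u : 'rV[R]_n -> R) :
  open Omega -> (0 < r)%R -> cube c r `<=` Omega -> Ck_on 2 Omega u ->
  (forall x, Omega x -> (1 <= laplacian u x)%R) ->
  (((r / 2) ^+ 4 * r) ^+ n)%:E <=
  (n%:R * (1 + r ^+ 4 + 16 * r ^+ 2) ^+ n)%:E *
    \int[lebesgue_rV R n]_(x in cube c r) `|u x|%:E.
Proof.
move=> oO r0 QO Cu lapu; set M := (n%:R * _)%R.
have r0' := ltW r0.
have M0 : (0 <= M)%R by rewrite mulr_ge0// exprn_ge0//; nra.
have mQ := measurable_cube c r.
pose g i := green_integrand c r i u.
have cu x : Omega x -> {for x, continuous u} by case: Cu => + _; exact.
have intg i := integrable_cube oO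
  (fun x => @continuous_green_integrand _ _ Omega c r i u x Cu) r0' QO.
have intu : (lebesgue_rV R n).-integrable (cube c r)
    (EFin \o (fun x => M * `|u x|)%R).
  apply: (integrable_cube oO) => // x Ox; apply: (@continuousM _ _ (cst M)).
    exact: cst_continuous.
  apply: (@continuous_comp _ _ _ u Num.norm); first exact: cu.
  exact: norm_continuous.
have intb := integrable_cube oO
  (fun x _ => @continuous_cube_bell R n c r x) r0' QO.
have intG := @integrable_sum _ _ _ (lebesgue_rV R n) _ mQ _ (index_enum 'I_n)
  xpredT (fun i => EFin \o g i) (fun i _ => intg i).
have intG0 : \int[lebesgue_rV R n]_(x in cube c r)
    (\sum_(i < n) (g i x)%:E) = 0.
  rewrite (integral_sum mQ intg); apply: big1 => i _.
  exact: (@integral_cube_green_coord _ _ Omega).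
have -> : M%:E * \int[lebesgue_rV R n]_(x in cube c r) `|u x|%:E =
    \int[lebesgue_rV R n]_(x in cube c r)
      (\sum_(i < n) (g i x)%:E + (M * `|u x|)%:E).
  rewrite integralD; [|exact: mQ|exact: intG|exact: intu].
  rewrite intG0 add0e; under [RHS]eq_integral do rewrite EFinM.
  rewrite ge0_integralZl//.
  apply/measurable_EFinP/measurableT_comp => //.
  apply: (@measurable_funS _ _ (borel_rV R n) _ Omega) => //.
    exact: measurable_open_rV.
  exact: measurable_continuous_rV.
apply: (@le_trans _ _
  (\int[lebesgue_rV R n]_(x in cube c r) (cube_bell c r x)%:E)).
  apply: (@le_trans _ _
    (\int[lebesgue_rV R n]_(x in cube c (r / 2)) (cube_bell c r x)%:E)).
    have -> : (((r / 2) ^+ 4 * r) ^+ n)%:E =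
        \int[lebesgue_rV R n]_(x in cube c (r / 2)) (((r / 2) ^+ 4) ^+ n)%:E.
      rewrite integral_cst; last exact: measurable_cube.
      rewrite [X in _ = _ * X]lebesgue_cube ?divr_ge0// -EFinM -exprMn.
      by congr (EFin ((_ * _) ^+ _)%R); lra.
    apply: ge0_le_integral.
    - exact: measurable_cube.
    - by move=> x _; rewrite lee_fin !exprn_ge0 ?divr_ge0.
    - exact: measurable_cst.
    - apply/measurable_EFinP.
      apply: (@measurable_funS _ _ (borel_rV R n) _ setT) => //.
      apply: measurable_continuous_rV; first exact: openT.
      by move=> x _; exact: continuous_cube_bell.
    - by move=> x Qx; rewrite lee_fin cube_bell_ge.
  apply: ge0_subset_integral.
  - exact: measurable_cube.
  - exact: measurable_cube.
  - exact: measurable_int intb.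
  - by move=> x _; rewrite lee_fin cube_bell_ge0.
  - move=> x Qx i; have := Qx i; rewrite !in_itv /= => /andP[h1 h2].
    by apply/andP; split; lra.
apply: (le_integral mQ intb (integrableD mQ intG intu)).
move=> x; rewrite inE => Qx; rewrite sumEFin -EFinD lee_fin.
rewrite /g /green_integrand sumrB -mulr_sumr -mulr_sumr -/(laplacian u x).
have h1 : (cube_bell c r x <= cube_bell c r x * laplacian u x)%R.
  by rewrite ler_peMr ?cube_bell_ge0// lapu//; exact: QO.
have h2 : (u x * \sum_(i < n) ddcube_bell c r i x <= M * `|u x|)%R.
  rewrite (le_trans (ler_norm _))// normrM mulrC ler_wpM2r//.
  rewrite (le_trans (ler_norm_sum _ _ _))//.
  rewrite /M mulr_natl -[X in (_ *+ X)%R]card_ord -sumr_const.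
  by apply: ler_sum => i _; exact: norm_ddcube_bell_le.
lra.
Qed.

End mass_on_cube.

Theorem theorem1 (R : realType) (n : nat) (Omega : set 'rV[R]_n) :
  (1 <= n)%N -> Omega !=set0 -> open Omega -> bounded_set Omega ->
  exists c : R, 0 < c /\
    forall u : 'rV[R]_n -> R,
      smooth_on Omega u ->
      (forall x, Omega x -> 1 <= laplacian u x) ->
      forall p : \bar R, (1 <= p)%E ->
        (c%:E <= Lnorm (lebesgue_rV R n) p (EFin \o (u \_ Omega)) *
           lebesgue_rV R n [set x | Omega x /\ (c <= `|u x|)%R]
             `^ fine ((hoelder_conjugate p)^-1)%E)%E.
Proof.
move=> n1 [x0 Ox0] oO _.
have [r r0 QO] := open_cube oO Ox0.
pose a := ((r / 2) ^+ 4 * r) ^+ n.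
pose M := n%:R * (1 + r ^+ 4 + 16 * r ^+ 2) ^+ n.
pose m := (r *+ 2) ^+ n.
have a0 : 0 < a by rewrite exprn_gt0// mulr_gt0// exprn_gt0// divr_gt0.
have M0 : 0 < M.
  rewrite mulr_gt0 ?ltr0n// exprn_gt0//.
  have := exprn_gt0 4 r0; have := exprn_gt0 2 r0; lra.
have m0 : 0 < m by rewrite exprn_gt0// mulrn_wgt0.
pose c := a / (M * (m + 1)).
have c0 : 0 < c by rewrite divr_gt0// mulr_gt0// addr_gt0.
exists c; split => // u su lapu p p1.
have mO : measurable (Omega : set (borel_rV R n)) by exact: measurable_open_rV.
have u_meas : measurable_fun (Omega : set (borel_rV R n))
    (u : borel_rV R n -> R).
  by apply: measurable_continuous_rV => //; have [] := su 0%N.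
set E : set (borel_rV R n) := [set x | Omega x /\ c <= `|u x|].
have mE : measurable E.
  have -> : E = Omega `&` (Num.norm \o u) @^-1` `[c, +oo[.
    by apply/seteqP; split => x /=; rewrite in_itv /= andbT.
  have mnu : measurable_fun (Omega : set (borel_rV R n))
    (Num.norm \o u : borel_rV R n -> R).
    exact: measurableT_comp.
  exact: mnu.
have muO := (measurable_restrictT _ mO).1 u_meas.
apply: le_trans (@integral_le_Lnorm_measure _ (borel_rV R n) R
  (lebesgue_rV R n) (u \_ Omega) E p muO mE p1).
have -> : (\int[lebesgue_rV R n]_(x in E) `|(u \_ Omega) x|%:E =
    \int[lebesgue_rV R n]_(x in E) `|u x|%:E)%E.
  by apply: eq_integral => x; rewrite inE => -[Ox _]; rewrite patchE mem_set.
set I := (\int[_]_(x in E) _)%E.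
have := integral_cube_ge oO r0 QO (su 2) lapu.
rewrite -/a -/M => aM.
(* Off [E] the function [|u|] is at most [c], and [m] is the measure of the
   cube. *)
have splitQ : (\int[lebesgue_rV R n]_(x in cube x0 r) `|u x|%:E <=
    (c * m)%:E + I)%E.
  have mQ := measurable_cube x0 r.
  have mEQ (D : set (borel_rV R n)) : D `<=` Omega ->
      measurable_fun D (fun x : borel_rV R n => `|u x|%:E).
    move=> DO; apply/measurable_EFinP; apply: measurableT_comp => //.
    by apply: (@measurable_funS _ _ (borel_rV R n) _ Omega).
  have EO : E `<=` Omega by move=> x [].
  apply: (@le_trans _ _ (\int[lebesgue_rV R n]_(x in cube x0 r)
      (c%:E + ((fun x => `|u x|%:E) \_ E) x))%E).
    apply: ge0_le_integral => //.
    - exact: mEQ.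
    - apply: emeasurable_funD => //.
      by apply: measurable_funTS; apply/(measurable_restrictT _ mE); exact: mEQ.
    - move=> x Qx; rewrite patchE; case: ifPn => xE.
        by rewrite leeDr// lee_fin ltW.
      rewrite adde0 lee_fin leNgt; apply: contra xE => /ltW cu.
      by rewrite inE; split => //; exact: QO.
  have m1 : measurable_fun (cube x0 r : set (borel_rV R n))
      ((fun x : borel_rV R n => `|u x|%:E) \_ E).
    by apply: measurable_funTS; apply/(measurable_restrictT _ mE); exact: mEQ.
  have w0 x : (0 <= ((fun x : borel_rV R n => `|u x|%:E) \_ E) x)%E.
    by rewrite patchE; case: ifP.
  rewrite ge0_integralD//; last by move=> x _; rewrite lee_fin ltW.
  apply: leeD.
    by rewrite integral_cst// [X in (_ * X <= _)%E](lebesgue_cube x0 (ltW r0)).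
  rewrite /I [X in (_ <= X)%E]integral_mkcond.
  apply: ge0_subset_integral => //.
  by apply/(measurable_restrictT _ mE); exact: mEQ.
have {aM splitQ} h := le_trans aM (lee_wpmul2l _ splitQ).
have {}h : (a%:E <= M%:E * ((c * m)%:E + I))%E by apply: h; rewrite lee_fin ltW.
have aE : a = M * (c * m + c) by rewrite /c; field; rewrite !gt_eqF// addr_gt0.
move: h; rewrite {1}aE EFinM lee_pmul2l// ?lte_fin// EFinD leeD2lE//.
Qed.
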